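(* Let $0<\alpha<1$ be a real number and let $t\geq 1$ be an integer. Then there exists $n_0=n_0(\alpha,t)$ such that for every $n\geq n_0$ and every $Q_t$-minor-free graph $G$ of order $n$, $$\rho_{\alpha}(G)\leq \rho_{\alpha}(K_t\vee M_{n-t}),$$ with equality if and only if $G=K_t\vee M_{n-t}$ (up to isomorphism).
   Context: All graphs are finite, simple and undirected; the order of a graph is its number of vertices. For a graph $G$, $A(G)$ is its adjacency matrix and $D(G)$ is the diagonal matrix of its vertex degrees. For $0\leq\alpha\leq 1$, $A_\alpha(G)=\alpha D(G)+(1-\alpha)A(G)$, and the $\alpha$-index $\rho_\alpha(G)$ is the largest eigenvalue of $A_\alpha(G)$. $K_n$ is the complete graph on $n$ vertices, and $G\vee H$ is the join of vertex-disjoint graphs $G$ and $H$, obtained from their disjoint union by joining every vertex of $G$ to every vertex of $H$. $M_{n-t}$ is the graph on $n-t$ vertices whose edge set consists of $\lfloor\frac{n-t}{2}\rfloor$ pairwise disjoint edges (so there is one isolated vertex if $n-t$ is odd, and none otherwise). $Q_t$ is the graph obtained from $t$ quadrangles (cycles of length $4$) by sharing one common vertex, the quadrangles being otherwise vertex-disjoint; it has $3t+1$ vertices and $4t$ edges. A graph $H$ is a minor of $G$ if $H$ can be obtained from a subgraph of $G$ by contracting edges; $G$ is $H$-minor-free if $H$ is not a minor of $G$. *)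

(* Defs.v *)
From HB Require Import structures.
From mathcomp Require Import all_boot all_order all_algebra.
From mathcomp Require Import unstable boolp classical_sets reals.
From mathcomp Require polyrcf complex spectral.

Set Implicit Arguments.
Unset Strict Implicit.
Unset Printing Implicit Defensive.

Import Order.TTheory GRing.Theory Num.Theory.
Local Open Scope ring_scope.

Record sgraph := SGraph {
  vertex :> finType;
  edge : rel vertex;
  edge_sym : symmetric edge;
  edge_irr : irreflexive edge }.

Definition isomorphic (G H : sgraph) : Prop :=
  exists f : G -> H, bijective f /\ forall x y, edge (f x) (f y) = edge x y.

Definition degree (G : sgraph) (x : G) : nat := #|[pred y | edge x y]|.

Section Complete.
Variable n : nat.
Definition complete_edge : rel 'I_n := fun i j => i != j.
Lemma complete_sym : symmetric complete_edge.
Proof. by move=> i j; rewrite /complete_edge eq_sym. Qed.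
Lemma complete_irr : irreflexive complete_edge.
Proof. by move=> i; rewrite /complete_edge eqxx. Qed.
Definition complete : sgraph := SGraph complete_sym complete_irr.
End Complete.

(* The edges are {0, 1}, {2, 3}, ...; for m odd, m - 1 is isolated. *)
Section Matching.
Variable m : nat.
Definition matching_edge : rel 'I_m := fun i j => (i != j) && (i./2 == j./2).
Lemma matching_sym : symmetric matching_edge.
Proof. by move=> i j; rewrite /matching_edge eq_sym [i./2 == _]eq_sym. Qed.
Lemma matching_irr : irreflexive matching_edge.
Proof. by move=> i; rewrite /matching_edge eqxx. Qed.
Definition matching : sgraph := SGraph matching_sym matching_irr.
End Matching.

Section Join.
Variables G H : sgraph.
Definition join_edge : rel (G + H)%type := fun u v =>
  match u, v with
  | inl x, inl y => edge x y
  | inr x, inr y => edge x y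
  | _, _ => true
  end.
Lemma join_sym : symmetric join_edge.
Proof. by case=> x [y|y] //=; apply: edge_sym. Qed.
Lemma join_irr : irreflexive join_edge.
Proof. by case=> x /=; apply: edge_irr. Qed.
Definition join : sgraph := SGraph join_sym join_irr.
End Join.

(* None is the common vertex; the i-th quadrangle is
   None - (i, 0) - (i, 1) - (i, 2) - None. *)
Section Quadrangles.
Variable t : nat.
Definition quadrangles_edge : rel (option ('I_t * 'I_3)) := fun u v =>
  match u, v with
  | None, None => false
  | None, Some (_, k) | Some (_, k), None => k != 1%N :> nat
  | Some (i, k), Some (j, l) =>
      (i == j) && ((k.+1 == l :> nat) || (l.+1 == k :> nat))
  end.
Lemma quadrangles_sym : symmetric quadrangles_edge.
Proof. by case=> [[i k]|] [[j l]|] //=; rewrite eq_sym orbC. Qed.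
Lemma quadrangles_irr : irreflexive quadrangles_edge.
Proof. by case=> [[i k]|] //=; rewrite eqxx orbb gtn_eqF. Qed.
Definition quadrangles : sgraph := SGraph quadrangles_sym quadrangles_irr.
End Quadrangles.

(* Identifying v with u: the merged vertex is represented by u, and loops and
   multiple edges are discarded. *)
Section Contract.
Variables (G : sgraph) (u v : G).
Definition contract_edge : rel {x : G | x != v} := fun x y =>
  (x != y) && [|| edge (val x) (val y),
                  (val x == u) && edge v (val y) |
                  (val y == u) && edge v (val x)].
Lemma contract_sym : symmetric contract_edge.
Proof.
by move=> x y; rewrite /contract_edge eq_sym edge_sym; congr (_ && (_ || _)); rewrite orbC.
Qed.
Lemma contract_irr : irreflexive contract_edge.
Proof. by move=> x; rewrite /contract_edge eqxx. Qed.
Definition contract : sgraph := SGraph contract_sym contract_irr.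
End Contract.

Inductive contracts_to (H : sgraph) : sgraph -> Prop :=
| contracts_refl : contracts_to H H
| contracts_step (G : sgraph) (u v : G) :
    edge u v -> contracts_to H (contract u v) -> contracts_to H G.

(* S is, up to isomorphism, a (not necessarily induced) subgraph of G. *)
Definition subgraph (S G : sgraph) : Prop :=
  exists f : S -> G, injective f /\ forall x y, edge x y -> edge (f x) (f y).

Definition minor (H G : sgraph) : Prop :=
  exists S K : sgraph, [/\ subgraph S G, contracts_to K S & isomorphic K H].

Definition minor_free (H G : sgraph) : Prop := ~ minor H G.

Section AlphaIndex.
Variables (R : realType) (alpha : R) (G : sgraph).

Definition adjacency_mx : 'M[R]_#|G| :=
  \matrix_(i, j) (edge (enum_val i) (enum_val j))%:R.

Definition degree_mx : 'M[R]_#|G| :=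
  diag_mx (\row_i (degree (enum_val i))%:R).

Definition alpha_mx : 'M[R]_#|G| :=
  alpha *: degree_mx + (1 - alpha) *: adjacency_mx.

(* The supremum is attained as soon as G has a vertex: see alpha_indexP. *)
Definition alpha_index : R := sup [set a : R | eigenvalue alpha_mx a]%classic.
End AlphaIndex.

Lemma alpha_mx_sym (R : realType) (alpha : R) (G : sgraph) :
  (alpha_mx alpha G)^T = alpha_mx alpha G.
Proof.
rewrite /alpha_mx linearD !linearZ /= tr_diag_mx; congr (_ + _ *: _).
by apply/matrixP => i j; rewrite !mxE edge_sym.
Qed.

Section RealSymmetric.
Import complex.
Local Open Scope complex_scope.

Lemma symmetric_eigenvalue (R : realType) n (A : 'M[R]_n) :
  (0 < n)%N -> A^T = A -> exists a, eigenvalue A a.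
Proof.
move=> n0 Asym; pose f := real_complex R; pose B := map_mx f A.
have [a Ba] := spectral.eigenvalue_closed B n0.
have [v vB vN0] := eigenvalueP Ba.
pose w := map_mx (@Num.conj (R[i])) v.
have wB : w *m B = Num.conj a *: w.
  rewrite -map_mxZ -vB map_mxM; congr (_ *m _).
  by apply/matrixP=> i j; rewrite !mxE; exact/esym/conjc_real.
have Bs : B^T = B by rewrite /B map_trmx Asym.
have E : a * (v *m w^T) 0 0 = Num.conj a * (v *m w^T) 0 0.
  have: v *m B *m w^T = v *m (w *m B)^T by rewrite trmx_mul Bs mulmxA.
  by rewrite vB wB linearZ /= -scalemxAl -scalemxAr => /matrixP/(_ 0 0); rewrite !mxE.
have vw : (v *m w^T) 0 0 != 0.
  rewrite mxE psumr_neq0; last by move=> i _; rewrite !mxE mul_conjC_ge0.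
  have [i vi] := rV0Pn _ vN0.
  by apply/hasP; exists i; rewrite ?mem_index_enum //= !mxE mul_conjC_gt0.
have {}E := mulIf vw E.
exists (complex.Re a).
have aE : a = f (complex.Re a).
  case: a E {Ba vB wB} => x y /= [] /eqP; rewrite -addr_eq0 -mulr2n mulrn_eq0 /=.
  by move=> /eqP->.
move: Ba; rewrite aE !eigenvalue_root_char /B.
by rewrite -map_char_poly fmorph_root.
Qed.
End RealSymmetric.

Lemma alpha_indexP (R : realType) (alpha : R) (G : sgraph) : (0 < #|G|)%N ->
  eigenvalue (alpha_mx alpha G) (alpha_index alpha G) /\
  forall a, eigenvalue (alpha_mx alpha G) a -> a <= alpha_index alpha G.
Proof.
move=> G0; set A := alpha_mx alpha G.
have [a0 Aa0] := symmetric_eigenvalue G0 (alpha_mx_sym alpha G).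
have pN0 : char_poly A != 0 by rewrite monic_neq0 // char_poly_monic.
pose s := polyrcf.rootsR (char_poly A).
have sE a : (a \in s) = eigenvalue A a.
  by rewrite eigenvalue_root_char -polyrcf.roots_on_rootsR // in_itv.
pose m := \big[Num.max/a0]_(a <- s) a.
have Am : eigenvalue A m.
  rewrite /m big_seq; elim/big_ind: _ => // [x y Ax Ay|i]; last by rewrite sE.
  by case: leP.
have mub a : eigenvalue A a -> a <= m by rewrite -sE => as_; apply: le_bigmax_seq.
suff -> : alpha_index alpha G = m by [].
apply/eqP; rewrite eq_le; apply/andP; split.
  by apply: ge_sup; [exists m | move=> a /mub].
by apply: ub_le_sup => //; exists m => a /mub.
Qed.

(* Main.v *)
(** Let z be the Perron vector of A_alpha(G), with maximal entry z u = 1, and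
suppose rho(G) >= rho(K_t v M_(n-t)), which is at least
alpha(n-1) - (1-alpha) + (1-alpha)t/alpha - O(1/n). Only the absence of Q_t as a
subgraph is used: if t vertices other than v each had 3t common neighbours with
v, quadrangles through v and these vertices could be chosen greedily.
Counting walks of length two from u then gives alpha (n-1-deg u) = O(1), so the
vertices outside the core L, made of u and the at most t-1 vertices having 3t
common neighbours with u, have bounded degree and entries O(1/n). Inserting this
in the eigenvalue equation of x in L gives
  rho z_x <= alpha (deg x) z_x - (1-alpha) z_x + (1-alpha)/alpha S + O(1/n),
S being the sum of z over L, and S <= |L| <= t. Comparing with the lower bound,
first at x = u and then at each x in L, forces |L| = t and deg x = n-1. A path
with three vertices outside L would now complete a Q_t, so G - L has maximal
degree at most 1 and G embeds in K_t v M_(n-t) on the same vertices; as z > 0, a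
missing edge would make rho strictly smaller. *)

Require Import Defs.
From mathcomp Require Import all_boot all_order all_algebra reals.
From mathcomp Require complex spectral sesquilinear.
From mathcomp Require Import ring lra zify.

(** * Quadrangles and matchings *)

Lemma subgraph_minor (H G : sgraph) : subgraph H G -> minor H G.
Proof.
move=> HG; exists H, H; split=> //; first exact: contracts_refl.
by exists id; split=> //; exists id.
Qed.

(** The list is cut into blocks [a, b, c], one per quadrangle [u a b c], so position [3 * i + k]
    holds the vertex labelled [(i, k)] in [quadrangles]. *)
Fixpoint quad_list {G : sgraph} (u : G) (l : seq G) : bool :=
  match l with
  | [:: a, b, c & l'] =>
      [&& edge u a, edge a b, edge b c, edge c u & quad_list u l']
  | [::] => true
  | _ => false
  end.

Lemma quad_list_nth (G : sgraph) (u : G) l t i : quad_list u l ->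
  size l = 3 * t -> i < t ->
  [/\ edge u (nth u l (3 * i)), edge (nth u l (3 * i)) (nth u l (3 * i + 1)),
      edge (nth u l (3 * i + 1)) (nth u l (3 * i + 2)) &
      edge (nth u l (3 * i + 2)) u].
Proof.
elim: t i l => // t IH i [|a [|b [|c l]]] //=; try lia.
move=> /and5P[ua ab bc cu ql] sl; case: i => [|i] it; first by rewrite muln0.
have -> : 3 * i.+1 = (3 * i).+3 by lia.
by apply: (IH i l); lia.
Qed.

Lemma quad_list_subgraph (G : sgraph) (u : G) l t : quad_list u l ->
  size l = 3 * t -> uniq (u :: l) -> subgraph (quadrangles t) G.
Proof.
move=> ql sl /andP[ul Ul].
pose f (x : quadrangles t) : G :=
  if x is Some (i, k) then nth u l (3 * i + k) else u.
have lt3 (i : 'I_t) (k : 'I_3) : 3 * i + k < size l.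
  by rewrite sl; have := ltn_ord i; have := ltn_ord k; lia.
have edge0 (i : 'I_t) (k : 'I_3) : k != 1 :> nat -> edge u (nth u l (3 * i + k)).
  have [e0 _ _ e3] := quad_list_nth _ _ _ _ _ ql sl (ltn_ord i).
  case: k => -[|[|[|k]]] //= _ _; first by rewrite addn0.
  by rewrite edge_sym.
have edge1 (i : 'I_t) (k m : 'I_3) : k.+1 = m ->
    edge (nth u l (3 * i + k)) (nth u l (3 * i + m)).
  have [_ e1 e2 _] := quad_list_nth _ _ _ _ _ ql sl (ltn_ord i).
  move=> km; have := ltn_ord m; rewrite -km; move: (k : nat).
  by case=> [|[|k']] // _; rewrite addn0.
exists f; split.
  move=> [[i k]|] [[j m]|] //= /eqP.
  - rewrite nth_uniq // => /eqP E; congr (Some (_, _)); apply: val_inj => /=;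
    have := ltn_ord k; have := ltn_ord m; lia.
  - by move=> /eqP E; move: ul; rewrite -E mem_nth.
  - by move=> /eqP E; move: ul; rewrite E mem_nth.
move=> [[i k]|] [[j m]|] //= => [|k1|]; last exact: edge0.
  case/andP=> /eqP<- /orP[] /eqP E; first exact: edge1.
  by rewrite edge_sym; apply: edge1.
by rewrite edge_sym; apply: edge0.
Qed.

Definition codegree {G : sgraph} (u w : G) : nat :=
  #|[pred v | edge u v && edge w v]|.

(* F lists the vertices that the quadrangles must avoid, except at the vertices
   of W, which are the vertices opposite to u. *)
Lemma quad_list_greedy (G : sgraph) (u : G) (W F : seq G) :
  uniq (u :: W) -> {subset W <= F} ->
  (forall w, w \in W -> 2 * size W + size F <= codegree u w) ->
  exists l, [/\ quad_list u l, size l = 3 * size W, uniq (u :: l) &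
    forall x, x \in l -> x \in W \/ x \notin F].
Proof.
elim: W F => [|w W IH] F; first by exists [::].
rewrite [uniq _]/= inE negb_or => /and3P[/andP[uw uW] wW UW] WF cod.
pose A := [pred v | edge u v && edge w v]; pose B := [pred v in F].
have : 1 < #|[predD A & B]|.
  have := cod w (mem_head w W) => /= cw.
  have : #|[predI A & B]| <= size F.
    apply: leq_trans (card_size F); apply/subset_leq_card/subsetP => v.
    by rewrite !inE => /andP[].
  have : #|[predI A & B]| + #|[predD A & B]| = codegree u w := cardID B A.
  by move: cw; set p := #|_|; set q := #|_|; lia.
case/card_gt1P=> a [c [+ + ac]]; rewrite !inE.
move=> /and3P[aF ua wa] /and3P[cF uc wc].
have wF : w \in F by apply: WF; rewrite mem_head.
(* The list to avoid gains [a] and [c] while [2 * size W] drops by two, so the codegree bound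
   survives the recursion. *)
have [||x xW|l [ql sl + lW]] := IH [:: a, c & F].
- by rewrite /= uW.
- by move=> x xW; rewrite !inE WF ?orbT // inE xW orbT.
- apply: leq_trans (cod x _); last by rewrite inE xW orbT.
  by rewrite /= mulnS; clear; lia.
rewrite cons_uniq => /andP[ul Ul].
exists [:: a, w, c & l]; split=> //=.
- by rewrite ua edge_sym wa wc edge_sym uc.
- by rewrite sl mulnS.
- have WlF x : x \in W -> x \in F by move=> xW; apply: WF; rewrite inE xW orbT.
  have nl x : x \notin W -> x \in [:: a, c & F] -> x \notin l.
    by move=> xW xF; apply/negP => /lW[]; rewrite ?(negPf xW) ?xF.
  have neq (x y : G) : edge x y -> x != y by apply: contraTneq => ->; rewrite edge_irr.
  have wl : w \notin l by apply: nl; rewrite // !inE wF !orbT.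
  have al : a \notin l.
    by apply: nl; rewrite ?mem_head //; apply: contraNN aF => /WlF.
  have cl : c \notin l.
    by apply: nl; rewrite ?inE ?eqxx ?orbT //; apply: contraNN cF => /WlF.
  rewrite !inE !negb_or uw ul wl al cl ac [a == w]eq_sym.
  by rewrite (neq _ _ ua) (neq _ _ uc) (neq _ _ wc) (neq _ _ wa).
move=> x; rewrite !inE => /or4P[/eqP->|/eqP->|/eqP->|/lW[->|]]; rewrite ?eqxx ?orbT; auto.
by rewrite !inE !negb_or => /and3P[]; auto.
Qed.

(** Induction peels off one edge at a time: its ends take positions 0 and 1, and all later halved
    positions shift by one. Degrees within [V] are at most one, so no other edge meets the removed
    pair. The halved index is how [matching] recognises its edges. *)
Lemma pairing (G : sgraph) (V : seq G) : uniq V ->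
  (forall x y z, x \in V -> y \in V -> z \in V -> edge x y -> edge x z -> y = z) ->
  exists s, perm_eq s V /\ forall x y, x \in V -> y \in V -> edge x y ->
    (index x s)./2 = (index y s)./2.
Proof.
have [m] := ubnP (size V); elim: m V => // m IH V sV UV V1.
have [/existsP[x /existsP[y /and3P[xV yV xy]]]|] :=
  boolP [exists x, exists y, [&& x \in V, y \in V & edge x y]]; last first.
  move=> /existsPn noE; exists V; split=> // x y xV yV xy.
  by have /existsPn/(_ y) := noE x; rewrite xV yV xy.
have neq : x != y by apply: contraTneq xy => ->; rewrite edge_irr.
have VE : perm_eq V [:: x, y & rem y (rem x V)].
  apply: perm_trans (perm_to_rem xV) _; rewrite perm_cons perm_to_rem //.
  by rewrite (rem_filter _ UV) mem_filter /= eq_sym neq yV.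
move: VE; set V' := rem y _ => VE.
have UE := perm_uniq VE; rewrite UV in UE; move/esym: UE.
rewrite /= inE negb_or => /andP[/andP[_ xV'] /andP[yV' UV']].
have VV' z : z \in V' -> z \in V by move=> zV'; rewrite (perm_mem VE) !inE zV' !orbT.
have [|//|a b c aV bV cV|s [sV' s2]] := IH V'.
- by have := perm_size VE => /=; lia.
- by apply: V1; apply: VV'.
exists [:: x, y & s]; split.
  by rewrite perm_sym (perm_trans VE) // !perm_cons perm_sym.
have xE z : z \in V -> edge x z -> z = y by move=> zV xz; apply: (V1 x z y).
have yE z : z \in V -> edge y z -> z = x.
  by move=> zV yz; apply: (V1 y z x) => //; rewrite edge_sym.
move=> a b aV bV ab /=; move: (aV) (bV); rewrite !(perm_mem VE) !inE.
rewrite ![_ == a]eq_sym ![_ == b]eq_sym.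
have [ax _|ax] := eqVneq a x.
  have -> : b = y by apply: xE; rewrite // -ax.
  by rewrite [y == x]eq_sym (negPf neq) eqxx.
have [ay _|ay] := eqVneq a y.
  have -> : b = x by apply: yE; rewrite // -ay.
  by rewrite eqxx.
move=> /= aV'.
have [bx|bx] := eqVneq b x.
  by case/eqP: ay; apply: xE; rewrite // -bx edge_sym.
have [b_y|b_y] := eqVneq b y.
  by case/eqP: ax; apply: yE; rewrite // -b_y edge_sym.
by move=> /= bV' /=; congr _.+1; apply: s2.
Qed.

(** The set [L] fills the clique and its complement is listed by [pairing]; edges between the two
    sides cost nothing in a join. Injectivity and equal cardinalities give bijectivity. *)
Lemma join_matching_embed (G : sgraph) (L : {set G}) :
  (forall x y z, x \notin L -> y \notin L -> z \notin L ->
    edge x y -> edge x z -> y = z) ->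
  exists f : G -> join (complete #|L|) (matching (#|G| - #|L|)),
    bijective f /\ forall x y, edge x y -> edge (f x) (f y).
Proof.
move=> L1.
have [|x y z|s [sE s2]] := pairing _ (enum (~: L)); first exact: enum_uniq.
  by rewrite !mem_enum !inE; apply: L1.
have ss : size s = #|G| - #|L| by rewrite (perm_size sE) -cardE cardsCs setCK.
have sL x : (x \in s) = (x \notin L) by rewrite (perm_mem sE) mem_enum inE.
pose P x (y : join (complete #|L|) (matching (#|G| - #|L|))) :=
  match y with
  | inl i => (x \in L) /\ i = index x (enum L) :> nat
  | inr k => (x \notin L) /\ k = index x s :> nat
  end.
have [x|f fP] := @fin_all_exists _ _ P.
  have [xL|xL] := boolP (x \in L).
    have ix : index x (enum L) < #|L| by rewrite cardE index_mem mem_enum.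
    by exists (inl (Ordinal ix)).
  have ix : index x s < #|G| - #|L| by rewrite -ss index_mem sL.
  by exists (inr (Ordinal ix)).
have index_inj (r : seq G) x y : x \in r -> y \in r -> index x r = index y r -> x = y.
  by move=> xr yr E; rewrite -(nth_index x xr) E nth_index.
have f_inj : injective f.
  move=> x y fxy; have := fP x; have := fP y; rewrite fxy.
  case: (f y) => i [yL iy] [xL ix]; rewrite ix in iy.
    by apply: (index_inj (enum L)); rewrite ?mem_enum.
  by apply: (index_inj s); rewrite ?sL.
exists f; split.
  apply: inj_card_bij => //.
  by rewrite card_sum !card_ord subnKC // max_card.
move=> x y xy; have := fP x; have := fP y.
have : f x != f y by apply: contraTneq xy => /f_inj->; rewrite edge_irr.
case: (f x) (f y) => [i|i] [j|j] //= ij [yL jy] [xL ix].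
apply/andP; split; first by apply: contra_neq ij => ->.
by rewrite ix jy; apply/eqP/s2; rewrite // mem_enum inE.
Qed.

Lemma dominating_edge (G : sgraph) (x y : G) :
  degree x = #|G|.-1 -> y != x -> edge x y.
Proof.
move=> dx yx; have /(_ y) : [pred v | edge x v] =i predC1 x.
  apply/subset_cardP; first by rewrite -[LHS]/(degree x) dx cardC1.
  by apply/subsetP => v; rewrite !inE; apply: contraTneq => ->; rewrite edge_irr.
by rewrite !inE yx.
Qed.

(** A path [a b c] outside [L] closes to a quadrangle through some [u] in [L]. Each of the other t-1
    vertices of [L] has n-2 common neighbours with [u], and the greedy choice avoiding [a, b, c]
    asks for 2(t-1) + (t-1) + 3 = 3t. *)
Lemma dominated_matching (G : sgraph) (t : nat) (L : {set G}) :
  minor_free (quadrangles t) G -> 0 < #|L| -> #|L| = t -> 3 * t + 2 <= #|G| ->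
  (forall x, x \in L -> degree x = #|G|.-1) ->
  forall x y z, x \notin L -> y \notin L -> z \notin L ->
    edge x y -> edge x z -> y = z.
Proof.
have arith (p g : nat) : 3 * p + 2 <= g -> 0 < p -> 2 * p.-1 + p.-1.+3 <= g - 2.
  lia.
move=> Gfree /card_gt0P[u uL] Lt tG dom b a c bL aL cL ba bc.
apply/eqP; apply: contraTT isT => ac; case: Gfree; apply: subgraph_minor.
have t0 : 0 < t by rewrite -Lt (cardsD1 u) uL.
have domE x y : x \in L -> y != x -> edge x y by move=> /dom; apply: dominating_edge.
pose W := enum (L :\ u).
have sW : size W = t.-1 by rewrite -cardE -Lt (cardsD1 u L) uL.
have UW : uniq (u :: W) by rewrite /= enum_uniq mem_enum !inE eqxx.
have WL x : x \in W -> x \in L by rewrite mem_enum !inE => /andP[].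
have [x xW|w wW|l [ql sl Ul lW]] := quad_list_greedy G u W [:: a, b, c & W] UW.
- by rewrite !inE xW !orbT.
- have wu : w != u by move: wW; rewrite mem_enum !inE => /andP[].
  have cw : #|predC (pred2 u w)| = #|G| - 2.
    by have := cardC (pred2 u w); rewrite card2 eq_sym wu /= => <-; rewrite addKn.
  have le : #|predC (pred2 u w)| <= codegree u w.
    apply/subset_leq_card/subsetP => v; rewrite !inE negb_or => /andP[vu vw].
    by rewrite !domE // WL.
  apply: leq_trans le; rewrite cw /= sW.
  exact: arith.
have notl x : x \notin L -> x \in [:: a; b; c] -> x \notin l.
  move=> xL xabc; apply/negP => /lW[/WL|]; first exact/negP.
  by rewrite -[[:: a, b, c & W]]/([:: a; b; c] ++ W) mem_cat xabc.
have neq (x y : G) : edge x y -> x != y by apply: contraTneq => ->; rewrite edge_irr.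
have nu x : x \notin L -> x != u by apply: contraNneq => ->.
apply: (quad_list_subgraph _ u [:: a, b, c & l]).
- by rewrite /= ql [edge a b]edge_sym ba bc [edge c u]edge_sym !domE ?nu.
- by rewrite /= sl sW -[in RHS](prednK t0) mulnS.
move: Ul; rewrite !cons_uniq => /andP[ul ->].
rewrite !inE !negb_or ul ac ![u == _]eq_sym !nu // [a == b]eq_sym (neq b a) //.
by rewrite (neq b c) // !notl ?inE ?eqxx ?orbT.
Qed.

Import Order.TTheory GRing.Theory Num.Theory.
Local Open Scope ring_scope.

(** * The alpha-index as a maximal Rayleigh quotient *)

Section Rayleigh.
Import complex sesquilinear spectral.
Local Open Scope complex_scope.
Local Open Scope sesquilinear_scope.

(** Over the complex numbers [A] is unitarily diagonalisable; in the coordinates [w] both forms are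
    sums of squared moduli, and the diagonal weights are real eigenvalues, hence at most [r]. *)
Lemma rayleigh_le (R : realType) n (A : 'M[R]_n) (r : R) (x : 'rV_n) :
  A^T = A -> (forall a, eigenvalue A a -> a <= r) ->
  (x *m A *m x^T) 0 0 <= r * (x *m x^T) 0 0.
Proof.
move=> Asym Ar; pose f := real_complex R; pose B := map_mx f A.
have realf m p (M : 'M[R]_(m, p)) : (map_mx f M) ^ (@Num.conj R[i]) = map_mx f M.
  by apply/matrixP => i j; rewrite !mxE; exact: conjc_real.
have trf m p (M : 'M[R]_(m, p)) : (map_mx f M)^T = map_mx f M^T.
  by apply/matrixP => i j; rewrite !mxE.
have Bherm : B \is hermsymmx.
  apply/is_hermitianmxP; rewrite expr0 scale1r.
  by rewrite trf Asym realf.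
have /orthomx_spectralP B_eq := hermitian_normalmx Bherm.
have dreal := hermitian_spectral_diag_real Bherm.
set P := spectralmx B in B_eq; set d := spectral_diag B in B_eq dreal.
have Pu : P \is unitarymx by apply: spectral_unitarymx.
have dr i : d 0 i <= f r.
  have dE : d 0 i = f (complex.Re (d 0 i)).
    by rewrite -[LHS]RRe_real //; have /mxOverP := dreal.
  have Bd : eigenvalue B (d 0 i).
    apply/eigenvalueP; exists (row i P).
      rewrite [in LHS]B_eq !mulmxA -row_mul mulmxV ?unitarymx_unit //.
      by rewrite row1 -rowE row_diag_mx -scalemxAl -rowE.
    have := unitarymx_unit Pu; rewrite -row_free_unit => /row_freeP[Q PQ].
    apply: contra_eq_neq (congr1 (row i) PQ) => P0.
    rewrite row_mul P0 mul0mx; apply/eqP => /rowP/(_ i); rewrite !mxE eqxx.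
    by move=> /esym/eqP; rewrite oner_eq0.
  (* Being real, [d 0 i] is a root of the characteristic polynomial of [A] itself. *)
  move: Bd; rewrite dE lecR !eigenvalue_root_char /B -map_char_poly fmorph_root.
  by rewrite -eigenvalue_root_char => /Ar.
pose y := map_mx f x; pose w := y *m (P ^t*).
have yBy : f ((x *m A *m x^T) 0 0) = \sum_i d 0 i * `|w 0 i| ^+ 2.
  transitivity ((y *m B *m y ^t*) 0 0).
    by rewrite /y trf realf /B -!map_mxM [in RHS]mxE.
  rewrite B_eq invmx_unitary // !mulmxA -/w -mulmxA.
  have -> : P *m y ^t* = w ^t*.
    by rewrite /w trmx_mul map_mxM trmxCK.
  by rewrite mxE; apply: eq_bigr => i _; rewrite mul_mx_diag !mxE normCK; ring.
have yy : f ((x *m x^T) 0 0) = \sum_i `|w 0 i| ^+ 2.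
  transitivity ((y *m y ^t*) 0 0).
    by rewrite /y trf realf -!map_mxM [in RHS]mxE.
  have -> : y *m y ^t* = w *m w ^t*.
    rewrite /w trmx_mul map_mxM trmxCK mulmxA -(mulmxA y) -invmx_unitary //.
    by rewrite mulVmx ?unitarymx_unit // mulmx1.
  by rewrite mxE; apply: eq_bigr => i _; rewrite !mxE normCK.
rewrite -lecR [in leRHS]rmorphM /= -!/(f _) yBy yy mulr_sumr.
by apply: ler_sum => i _; rewrite ler_wpM2r // exprn_ge0.
Qed.
End Rayleigh.

(* Expand the form at x + s (x M), for s negative and small. *)
Lemma psd_kernel (R : realFieldType) n (M : 'M[R]_n) (x : 'rV_n) :
  M^T = M -> (forall y : 'rV_n, 0 <= (y *m M *m y^T) 0 0) ->
  (x *m M *m x^T) 0 0 = 0 -> x *m M = 0.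
Proof.
move=> Msym Mpsd xMx; set g := x *m M.
pose a := (g *m g^T) 0 0; pose b := (g *m M *m g^T) 0 0.
have aE : a = \sum_i g 0 i ^+ 2.
  by rewrite /a mxE; apply: eq_bigr => i _; rewrite !mxE expr2.
have addE (P Q : 'M[R]_1) : (P + Q) 0 0 = P 0 0 + Q 0 0 by rewrite mxE.
have scaleE k (P : 'M[R]_1) : (k *: P) 0 0 = k * P 0 0 by rewrite mxE.
have ge s : 0 <= s * 2 * a + s ^+ 2 * b.
  suff <- : ((x + s *: g) *m M *m (x + s *: g)^T) 0 0 = s * 2 * a + s ^+ 2 * b.
    exact: Mpsd.
  have gMx : (g *m M *m x^T) 0 0 = a.
    by rewrite /a -mulmxA; congr ((_ *m _) 0 0); rewrite trmx_mul Msym.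
  rewrite linearD /= linearZ /= !(mulmxDl, mulmxDr) -!(scalemxAl, scalemxAr).
  by rewrite !(addE, scaleE) xMx gMx -/a -/b; ring.
suff a0 : a = 0.
  apply/rowP => i; rewrite [RHS]mxE; apply/eqP; rewrite -sqrf_eq0.
  move/eqP: a0; rewrite aE psumr_eq0 => [/allP/(_ i)|j _]; last exact: sqr_ge0.
  by rewrite mem_index_enum => /(_ isT).
have a_ge0 : 0 <= a by rewrite aE sumr_ge0 // => i _; rewrite sqr_ge0.
apply/eqP; rewrite eq_le a_ge0 andbT leNgt; apply/negP => a_gt0.
(* At [s = - (a / d)] the form equals (a/d)^2 (b - 2d), which is negative because d > |b|. *)
pose d := `|b| + 1.
have d_gt0 : 0 < d by rewrite ltr_wpDl.
have := ge (- (a / d)); apply/negP; rewrite -ltNge.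
have -> : - (a / d) * 2 * a + (- (a / d)) ^+ 2 * b = (a / d) ^+ 2 * (b - 2 * d).
  by field; rewrite gt_eqF.
rewrite pmulr_rlt0 ?exprn_gt0 ?divr_gt0 //.
by have := ler_norm b; have := normr_ge0 b; rewrite /d; lra.
Qed.

(* The row of A_alpha at x applied to z: the degree term is spread over the sum. *)
Definition alpha_op {R : realType} (alpha : R) {G : sgraph} (z : G -> R) (x : G) : R :=
  \sum_(y | edge x y) (alpha * z x + (1 - alpha) * z y).

Definition vec {R : realType} {G : sgraph} (z : G -> R) : 'rV[R]_#|G| :=
  \row_i z (enum_val i).

Section AlphaOp.
Variables (R : realType) (alpha : R) (G : sgraph).
Local Notation rho := (alpha_index alpha G).
Local Notation op := (alpha_op alpha).

Lemma vec_alpha_mx (z : G -> R) : vec z *m alpha_mx alpha G = vec (op z).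
Proof.
apply/rowP => i; rewrite /alpha_mx mulmxDr -!scalemxAr /alpha_op mxE.
rewrite [X in X + _]mxE [X in _ + X]mxE [RHS]mxE big_split /= sumr_const -mulr_sumr.
congr (_ + _ * _).
  rewrite mul_mx_diag !mxE /degree mulr_natr -mulrnAr.
  by congr (_ * (_ *+ _)); apply: eq_card.
rewrite mxE [RHS]big_mkcond /= [in RHS](reindex (fun i : 'I_#|G| => enum_val i)) /=; last first.
  by apply: onW_bij; apply: enum_val_bij.
apply: eq_bigr => j _; rewrite !mxE edge_sym.
by case: edge; rewrite ?mulr1 ?mulr0.
Qed.

Lemma vec_dot (y z : G -> R) : (vec y *m (vec z)^T) 0 0 = \sum_x y x * z x.
Proof.
rewrite mxE [RHS](reindex (fun i : 'I_#|G| => enum_val i)) /=; last first.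
  by apply: onW_bij; apply: enum_val_bij.
by apply: eq_bigr => i _; rewrite !mxE.
Qed.

Lemma alpha_index_ge (z : G -> R) : (0 < #|G|)%N ->
  \sum_x z x * op z x <= rho * \sum_x z x * z x.
Proof.
move=> /(alpha_indexP alpha)[_ rho_max].
have := rayleigh_le _ _ _ _ (vec z) (alpha_mx_sym alpha G) rho_max.
rewrite vec_alpha_mx !vec_dot; congr (_ <= _).
by apply: eq_bigr => x _; rewrite mulrC.
Qed.

(** The absolute values of an eigenvector still reach the maximal Rayleigh quotient, so they lie in
    the kernel of the positive semidefinite [rho%:M - alpha_mx alpha G]; dividing by the largest
    entry gives [z u = 1]. As [G] may be disconnected, entries may vanish. *)
Lemma alpha_index_perron : 0 <= alpha <= 1 -> (0 < #|G|)%N ->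
  exists (z : G -> R) (u : G), [/\ forall x, 0 <= z x <= 1, z u = 1 &
    forall x, rho * z x = op z x].
Proof.
move=> alpha01 G0; have [/eigenvalueP[v vA v0] rho_max] := alpha_indexP alpha G0.
pose z0 x := v 0 (enum_rank x).
have vE : v = vec z0 by apply/rowP => i; rewrite !mxE /z0 enum_valK.
(* |z0| has the same norm as z0 and at least the same Rayleigh quotient. *)
pose w x := `|z0 x|.
have op0 x : rho * z0 x = op z0 x.
  move: vA; rewrite {1 2}vE vec_alpha_mx => /rowP/(_ (enum_rank x)).
  by rewrite !mxE enum_rankK.
have opw x : rho * w x = op w x.
  suff /rowP/(_ (enum_rank x)) : vec w *m (rho%:M - alpha_mx alpha G) = 0.
    rewrite mulmxBr mul_mx_scalar vec_alpha_mx !mxE enum_rankK.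
    by move/eqP; rewrite subr_eq0 => /eqP.
  have form y : (vec y *m (rho%:M - alpha_mx alpha G) *m (vec y)^T) 0 0 =
      rho * (\sum_x y x * y x) - \sum_x y x * op y x.
    rewrite mulmxBr mulmxBl mxE mul_mx_scalar -scalemxAl vec_alpha_mx mxE vec_dot.
    rewrite mxE vec_dot; congr (_ - _).
    by apply: eq_bigr => i _; rewrite mulrC.
  apply: psd_kernel => [|y|].
  - by rewrite linearB /= tr_scalar_mx alpha_mx_sym.
  - have -> : y = vec (fun x => y 0 (enum_rank x)).
      by apply/rowP => i; rewrite !mxE enum_valK.
    by rewrite form subr_ge0 alpha_index_ge.
  apply/eqP; rewrite form subr_eq0 eq_le alpha_index_ge // andbT.
  rewrite mulr_sumr; apply: ler_sum => y _.
  rewrite /w -normrM ger0_norm -?expr2 ?sqr_ge0 // expr2 mulrCA op0.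
  have [a0 a1] := andP alpha01.
  rewrite !mulr_sumr; apply: ler_sum => i _; apply: le_trans (ler_norm _) _.
  rewrite normrM ler_wpM2l //; apply: le_trans (ler_normD _ _) _.
  by rewrite !normrM (ger0_norm a0) [`|1 - _|]ger0_norm // subr_ge0.
have [u _ uP] := arg_maxP w (erefl : predT (enum_val (Ordinal G0))).
have wu : 0 < w u.
  rewrite lt_neqAle normr_ge0 andbT; apply: contra_neq v0 => wu0.
  apply/rowP => i; rewrite mxE; apply/eqP; rewrite -normr_le0 wu0.
  by have := uP (enum_val i) isT; rewrite /w /z0 enum_valK.
exists (fun x => w x / w u), u; split.
- by move=> x; rewrite divr_ge0 ?normr_ge0 //= ler_pdivrMr // mul1r; apply: uP.
- by rewrite divff ?gt_eqF.
move=> x; rewrite mulrA opw /alpha_op mulr_suml; apply: eq_bigr => y _.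
by rewrite mulrDl !mulrA.
Qed.
End AlphaOp.

(** Weighting the rowwise inequality by the nonnegative [z x] and summing bounds the Rayleigh
    quotient of [z] from below. *)
Lemma alpha_index_lower (R : realType) (alpha lambda : R) (G : sgraph)
    (z : G -> R) (u : G) :
  (forall x, 0 <= z x) -> 0 < z u ->
  (forall x, lambda * z x <= alpha_op alpha z x) ->
  lambda <= alpha_index alpha G.
Proof.
move=> z0 zu zop; have G0 : (0 < #|G|)%N by apply/card_gt0P; exists u.
have S0 : 0 < \sum_x z x * z x.
  rewrite (bigD1 u) //= ltr_pwDl ?mulr_gt0 // sumr_ge0 // => x _.
  exact: mulr_ge0.
rewrite -(ler_pM2r S0); apply: le_trans (alpha_index_ge _ alpha _ z G0).
rewrite mulr_sumr; apply: ler_sum => x _.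
by rewrite mulrCA ler_wpM2l.
Qed.

(** * Comparison of alpha-indices along a bijective homomorphism *)

Section Transport.
Variables (R : realType) (alpha : R) (G H : sgraph) (f : G -> H).
Hypotheses (alpha01 : 0 < alpha < 1) (G0 : (0 < #|G|)%N) (f_bij : bijective f).

(** The left side is the quadratic form of [H] at [z] carried over by [f], pulled back to [G] for a
    comparison row by row. *)
Lemma alpha_index_transport (z : G -> R) :
  \sum_x z x * (\sum_(y | edge (f x) (f y)) (alpha * z x + (1 - alpha) * z y))
  <= alpha_index alpha H * \sum_x z x * z x.
Proof.
have [g fK gK] := f_bij.
have H0 : (0 < #|H|)%N by rewrite -(bij_eq_card f_bij).
have := alpha_index_ge _ alpha _ (z \o g) H0.
have reindexf (P : pred H) F : \sum_(h | P h) F h = \sum_(x | P (f x)) F (f x) :> R.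
  by apply: reindex; apply: onW_bij.
rewrite (reindexf predT) [in leRHS](reindexf predT) /=.
congr (_ <= _ * _); apply: eq_bigr => x _; rewrite fK //.
by rewrite /alpha_op reindexf; congr (_ * _); apply: eq_bigr => y _ /=; rewrite !fK.
Qed.

Hypothesis f_hom : forall x y, edge x y -> edge (f x) (f y).

Lemma alpha_op_transport (z : G -> R) x : (forall y, 0 <= z y) ->
  alpha_op alpha z x
  <= \sum_(y | edge (f x) (f y)) (alpha * z x + (1 - alpha) * z y).
Proof.
move=> z0; rewrite /alpha_op big_mkcond [leRHS]big_mkcond /=.
apply: ler_sum => y _; case: ifP => [/f_hom->//|_]; case: ifP => // _.
by have [/ltW a0 /ltW a1] := andP alpha01; rewrite addr_ge0 ?mulr_ge0 ?subr_ge0.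
Qed.

Lemma alpha_index_mono : alpha_index alpha G <= alpha_index alpha H.
Proof.
have [|z [u [z01 zu zop]]] := alpha_index_perron _ alpha G _ G0.
  by have [/ltW-> /ltW->] := andP alpha01.
have z0 x : 0 <= z x by have /andP[] := z01 x.
have S0 : 0 < \sum_x z x * z x.
  rewrite (bigD1 u) //= zu ltr_pwDl ?mulr1 // sumr_ge0 // => x _.
  exact: mulr_ge0.
rewrite -(ler_pM2r S0); apply: le_trans (alpha_index_transport z).
rewrite mulr_sumr; apply: ler_sum => x _.
by rewrite mulrCA zop ler_wpM2l // alpha_op_transport.
Qed.

(** The extra edge adds at least alpha (z x)^2 > 0 to the form at [x], even if [z y] is zero. *)
Lemma alpha_index_strict (z : G -> R) x y : (forall x, 0 <= z x) ->
  (forall x, alpha_index alpha G * z x = alpha_op alpha z x) ->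
  0 < z x -> edge (f x) (f y) -> ~~ edge x y ->
  alpha_index alpha G < alpha_index alpha H.
Proof.
move=> z0 zop zx fxy xy; have [a0 a1] := andP alpha01.
have S0 : 0 < \sum_x z x * z x.
  rewrite (bigD1 x) //= ltr_pwDl ?mulr_gt0 // sumr_ge0 // => i _.
  exact: mulr_ge0.
rewrite -(ltr_pM2r S0); apply: lt_le_trans (alpha_index_transport z).
rewrite mulr_sumr (bigD1 x) //= [ltRHS](bigD1 x) //=.
apply: ltr_leD; last first.
  apply: ler_sum => i _.
  by rewrite mulrCA zop ler_wpM2l // alpha_op_transport.
rewrite mulrCA zop ltr_pM2l //.
rewrite /alpha_op big_mkcond [ltRHS]big_mkcond /= (bigD1 y) //= [ltRHS](bigD1 y) //=.
rewrite (negPf xy) fxy; apply: ltr_leD.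
  by rewrite ltr_pwDl ?mulr_ge0 ?mulr_gt0 // subr_ge0 ltW.
apply: ler_sum => i _; case: ifP => [/f_hom->//|_]; case: ifP => // _.
by rewrite addr_ge0 ?mulr_ge0 ?subr_ge0 // ltW.
Qed.
End Transport.

(** This is the slack, at a clique vertex, of lambda z <= A_alpha z for the test vector equal to 1
    on the clique and to [b] elsewhere, lambda being the lower bound of [alpha_index_join_ge]. The
    coefficient of 1/N is chosen so that the sum collapses to one positive fraction. *)
Lemma join_excess (R : realFieldType) (a N T : R) (c := (1 - a) / a * T)
  (b := (1 - a) * T / (a * N + c)) : 0 < a -> a < 1 -> 0 < T -> 0 < N ->
  0 <= (1 - a) ^+ 2 * T * (c + a * T) / a ^+ 2 / N - (1 - a) * c + (1 - a) * (N - T) * b.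
Proof.
move=> a0 a1 T0 N0; have b0 : 0 < 1 - a by rewrite subr_gt0.
have c0 : 0 < c by rewrite mulr_gt0 ?divr_gt0.
have d0 : 0 < a * N + c by rewrite addr_gt0 // mulr_gt0.
have aN0 : a * N + c != 0 by rewrite gt_eqF.
have ca : (1 - a) * T = a * c by rewrite /c; field; rewrite gt_eqF.
have -> : (1 - a) ^+ 2 * T * (c + a * T) / a ^+ 2 / N - (1 - a) * c + (1 - a) * (N - T) * b
 = (1 - a) ^+ 2 * T * (c + a * T) * c / (a ^+ 2 * N * (a * N + c)).
  have TE : T = a * c / (1 - a) by rewrite -ca mulrC mulKf ?gt_eqF.
  have -> : b = a * c / (a * N + c) by rewrite /b ca.
  clearbody c; rewrite TE.
  by field; rewrite aN0 !gt_eqF.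
clear aN0 ca b; clearbody c; move: (1 - a) b0 => e e0.
by apply/ltW/divr_gt0; rewrite !(mulr_gt0, exprn_gt0, addr_gt0).
Qed.

Lemma alpha_index_join_ge (R : realType) (alpha : R) (t n : nat)
    (K := (1 - alpha) ^+ 2 * t%:R * ((1 - alpha) / alpha * t%:R + alpha * t%:R)
          / alpha ^+ 2) :
  0 < alpha < 1 -> (0 < t <= n)%N ->
  alpha * (n%:R - 1) - (1 - alpha) + (1 - alpha) / alpha * t%:R - K / n%:R
  <= alpha_index alpha (join (complete t) (matching (n - t))).
Proof.
move=> /andP[a0 a1] /andP[t0 tn].
have T1 : 1 <= t%:R :> R by rewrite ler1n.
have T0 := lt_le_trans ltr01 T1.
have TN : t%:R <= n%:R :> R by rewrite ler_nat.
have N0 := lt_le_trans T0 TN.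
have b0 : 0 < 1 - alpha by rewrite subr_gt0.
have M0 : 0 < (1 - alpha) / alpha * t%:R by rewrite mulr_gt0 ?divr_gt0.
have aM : alpha * ((1 - alpha) / alpha * t%:R) = (1 - alpha) * t%:R.
  by field; rewrite gt_eqF.
have K0 : 0 <= K / n%:R.
  rewrite /K; move: (_ / alpha * _) M0 (1 - alpha) b0 => M M0 e e0.
  by apply: ltW; rewrite !(divr_gt0, mulr_gt0, exprn_gt0, addr_gt0).
have := join_excess _ _ _ _ a0 a1 T0 N0.
rewrite -/K; move: (K / _) K0 (_ / alpha * _) M0 aM => {}K K0 M M0 aM excess.
have aNM : 0 < alpha * n%:R + M by rewrite addr_gt0 ?mulr_gt0.
move: excess; set b := _ / (_ + M) => excess.
have hb : b * (alpha * n%:R + M) = (1 - alpha) * t%:R by rewrite divfK ?gt_eqF.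
have b_gt0 : 0 < b by rewrite divr_gt0 ?mulr_gt0.
clearbody b.
(* The Perron entry outside the clique is about (1 - alpha) t / (rho - alpha t);
   b replaces the denominator by alpha n + M. *)
pose z (x : join (complete t) (matching (n - t))) : R :=
  if x is inl _ then 1 else b.
apply: (@alpha_index_lower _ _ _ _ z (inl (Ordinal t0))) => [[i|k]||[i|k]] //=;
  try exact: ltW.
  rewrite /alpha_op big_sumType /= !sumr_const !mulr1.
  have -> : #|[pred j | @complete_edge t i j]| = t.-1.
    by rewrite -[in RHS](card_ord t) -(cardC1 i); apply: eq_card => j; rewrite !inE eq_sym.
  rewrite card_ord -[(_ + _) *+ t.-1]mulr_natr -[(_ + _) *+ (n - t)]mulr_natr -[t.-1]subn1 !natrB //.
  move: (t%:R) (n%:R) T1 TN T0 N0 aM aNM excess hb => T N T1 TN T0 N0 aM aNM excess hb.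
  clear z; lra.
rewrite /alpha_op big_sumType /=.
(* Only the edges to the clique are kept; a matching edge contributes a nonnegative term. *)
apply: le_trans (_ : \sum_(j < t) (alpha * b + (1 - alpha) * 1) <= _); last first.
  rewrite lerDl sumr_ge0 // => j _.
  by apply: addr_ge0; apply: mulr_ge0; apply: ltW.
rewrite sumr_const card_ord -[leRHS]mulr_natr.
(* By [hb], this product is exactly the difference of the two sides. *)
have : 0 <= b * (alpha * t%:R + 1 + K).
  by apply: mulr_ge0; [|apply: addr_ge0 => //; apply: addr_ge0 => //; apply: mulr_ge0]; apply: ltW.
move: (t%:R) (n%:R) T1 TN T0 N0 aM aNM excess hb => T N T1 TN T0 N0 aM aNM excess hb.
clear z; lra.
Qed.

(** * The core of a Perron vector *)

(** The threshold 3t is 2t + t: what the greedy choice asks for when the t opposite vertices are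
    themselves the list to avoid. *)
Lemma sparse_quadrangles (G : sgraph) (t : nat) (u : G) :
  minor_free (quadrangles t) G ->
  (#|[set w | (w != u) && (3 * t <= codegree u w)]| < t)%N.
Proof.
move=> Gfree; rewrite ltnNge; apply/negP => tW.
case: Gfree; apply: subgraph_minor.
set A := [set w | _] in tW; pose W := take t (enum A).
have sW : size W = t by rewrite size_takel // -cardE.
have WA w : w \in W -> w \in A by move/mem_take; rewrite mem_enum.
have UW : uniq (u :: W).
  rewrite /= take_uniq ?enum_uniq // andbT; apply/negP => /WA.
  by rewrite inE eqxx.
have [//|w /WA|l [ql sl Ul _]] := quad_list_greedy G u W W UW.
  rewrite inE sW => /andP[_]; apply: leq_trans.
  by rewrite [in leqRHS]mulSn addnC.
by apply: (quad_list_subgraph _ u l) => //; rewrite sl sW.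
Qed.

Lemma degree_codegree (G : sgraph) (v w : G) :
  (degree v + degree w <= codegree v w + #|G|)%N.
Proof.
have := cardUI [pred y | edge v y] [pred y | edge w y].
rewrite -[#|[pred y | edge v y]|]/(degree v) -[#|[pred y | edge w y]|]/(degree w) => <-.
by rewrite addnC leq_add ?max_card //; apply: subset_leq_card; apply/subsetP.
Qed.

(** Both sides count the walks of length two starting at [u]. *)
Lemma sum_codegree (G : sgraph) (u : G) :
  (\sum_(v | edge u v) degree v = \sum_w codegree u w)%N.
Proof.
under eq_bigr => v _ do rewrite /degree -sum1_card big_mkcond /=.
rewrite exchange_big /=; apply: eq_bigr => w _.
rewrite /codegree -sum1_card big_mkcond [RHS]big_mkcond /=.
apply: eq_bigr => v _; rewrite !inE edge_sym [edge w v]edge_sym.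
by case: (edge v u).
Qed.

(** Replaces N/(N-d) by 1 + O(1/N) with an explicit constant. Here [T] will be the sum of [z] over
    the neighbours outside the core; 2d <= N makes 2(N-d)/N at least 1. *)
Lemma core_row_arith (R : realFieldType) (a N S T c d t : R) :
  0 < a -> a < 1 -> 0 <= S -> S <= t -> 0 <= c -> 0 <= d -> 0 < N -> 2 * d <= N ->
  a * (N - d) * T <= (1 - a) * (N * S + c) ->
  (1 - a) * T <= (1 - a) ^+ 2 / a * S + 2 * (c + d * t) / a / N.
Proof.
move=> a0 a1 S0 St c0 d0 N0 dN TS.
have D0 : 0 < a * (N - d) by rewrite mulr_gt0 // subr_gt0; lra.
have b0 : 0 < 1 - a by rewrite subr_gt0.
rewrite -(ler_pM2l D0) mulrCA.
apply: le_trans (_ : (1 - a) * ((1 - a) * (N * S + c)) <= _); first by rewrite ler_pM2l.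
have -> : a * (N - d) * ((1 - a) ^+ 2 / a * S + 2 * (c + d * t) / a / N) =
   (1 - a) ^+ 2 * S * (N - d) + (c + d * t) * (2 * (N - d) / N).
  by field; rewrite !gt_eqF.
have : (c + d * t) * 1 <= (c + d * t) * (2 * (N - d) / N).
  rewrite ler_wpM2l //; last by rewrite ler_pdivlMr //; lra.
  by rewrite addr_ge0 // mulr_ge0 // (le_trans S0).
have e1 : (1 - a) ^+ 2 <= 1 by rewrite expr_le1 //; lra.
have : (1 - a) ^+ 2 * (c + d * S) <= 1 * (c + d * t).
  by apply: ler_pM; rewrite ?sqr_ge0 ?addr_ge0 ?mulr_ge0 ?lerD // ler_wpM2l.
move: ((c + d * t) * (_ / _)) => X; move: (1 - a) => e; rewrite !expr2; lra.
Qed.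

Section PerronVector.
Variables (R : realType) (alpha : R) (G : sgraph) (t : nat) (z : G -> R) (u : G).
Hypothesis alpha01 : 0 < alpha < 1.
Hypothesis Gfree : minor_free (quadrangles t) G.
Local Notation rho := (alpha_index alpha G).
Local Notation N := (#|G|%:R : R).
Hypotheses (z01 : forall x, 0 <= z x <= 1) (zu : z u = 1).
Hypothesis zop : forall x, rho * z x = alpha_op alpha z x.
Hypothesis rho_ge : alpha * (N - 1) <= rho.
Hypotheses (n12 : (12 <= #|G|)%N) (n9t : (9 * t <= #|G|)%N).

Let W := [set w | (w != u) && (3 * t <= codegree u w)%N].
Let L := u |: W.

Lemma card_core : (#|L| <= t)%N.
Proof.
have := sparse_quadrangles G t u Gfree; rewrite cardsU1 -/W.
by case: (_ \notin _) => /=; rewrite ?add0n ?add1n //; apply: ltnW.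
Qed.

Lemma perron_eq x :
  (rho - alpha * (degree x)%:R) * z x = (1 - alpha) * \sum_(y | edge x y) z y.
Proof.
rewrite mulrBl zop /alpha_op big_split /= sumr_const -mulr_sumr.
rewrite -[#|_|]/(degree x) -mulr_natr; ring.
Qed.

(** At most t core vertices contribute up to n each, every other vertex less than 3t. *)
Lemma sum_codegree_le : (\sum_w codegree u w <= 4 * t * #|G|)%N.
Proof.
have cod w : (codegree u w <= #|G|)%N by apply: max_card.
have -> : (4 * t * #|G| = t * #|G| + #|G| * (3 * t))%N by clear; lia.
rewrite (bigID [pred w in L]) /=; apply: leq_add.
  apply: leq_trans (_ : (\sum_(w in L) #|G| <= _)%N); first exact: leq_sum.
  by rewrite sum_nat_const leq_mul2r card_core orbT.
apply: leq_trans (_ : (\sum_(w | w \notin L) (3 * t) <= _)%N).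
  apply: leq_sum => w; rewrite !inE negb_or negb_and => /andP[->] /=.
  by rewrite -ltnNge; apply: ltnW.
by rewrite sum_nat_const leq_mul2r max_card orbT.
Qed.

(* Two vertices of B have at least n/3 common neighbours. *)
Let B := [set v : G | (2 * #|G| <= 3 * degree v)%N].

(** Since n/3 >= 3t, all other members of [B] fall under [sparse_quadrangles] at any fixed member,
    so they number fewer than t. *)
Lemma card_big : (#|B| <= t)%N.
Proof.
rewrite leqNgt; apply/negP => tB.
have /card_gt0P[v vB] : (0 < #|B|)%N by apply: leq_ltn_trans tB.
have := sparse_quadrangles G t v Gfree; rewrite ltnNge => /negP; apply.
apply: leq_trans (_ : (#|B :\ v| <= _)%N).
  by move: tB; rewrite (cardsD1 v B) vB.
apply/subset_leq_card/subsetP => w; rewrite !inE => /andP[-> wB] /=.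
have := degree_codegree G v w; rewrite inE in vB.
move: (degree v) (degree w) (codegree v w) vB wB n9t => a b c; move: #|G| => n.
clear; lia.
Qed.

Lemma sum_nbrs_degree_le :
  \sum_(v | edge u v) (degree v)%:R <= 4 * t%:R * N.
Proof.
rewrite -natr_sum sum_codegree -!natrM ler_nat; exact: sum_codegree_le.
Qed.

Lemma sum_nbrs_le x : \sum_(y | edge x y) z y <= (degree x)%:R.
Proof.
apply: le_trans (_ : \sum_(y | edge x y) 1 <= _).
  by apply: ler_sum => y _; have /andP[] := z01 y.
by rewrite sumr_const.
Qed.

(** A degree below 2n/3 leaves rho - alpha deg v >= alpha (n/3 - 1), and n/3 - 1 >= n/4 as n >=
    12. *)
Lemma small_entry v : v \notin B -> alpha * N / 4 * z v <= (degree v)%:R.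
Proof.
rewrite inE -ltnNge => vB; have [a0 a1] := andP alpha01.
have /andP[zv0 zv1] := z01 v.
apply: le_trans (_ : (rho - alpha * (degree v)%:R) * z v <= _).
  apply: ler_wpM2r => //.
  have dN : 3 * (degree v)%:R <= 2 * N by rewrite -!natrM ler_nat ltnW.
  have N12 : 12 <= N by rewrite (ler_nat _ 12).
  have : alpha * (3 * (degree v)%:R) <= alpha * (2 * N) by rewrite ler_pM2l.
  have : alpha * 12 <= alpha * N by rewrite ler_pM2l.
  move: rho (degree v)%:R N rho_ge => r d n r_ge; lra.
rewrite perron_eq; apply: le_trans (sum_nbrs_le v).
have S0 : 0 <= \sum_(y | edge v y) z y.
  by apply: sumr_ge0 => y _; have /andP[] := z01 y.
by rewrite ler_piMl // lerBlDr lerDl ltW.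
Qed.

(** In the row of [u], neighbours in [B] contribute at most t. For the others [small_entry] trades
    entries for degrees, whose sum is at most 4tn; dividing by alpha n/4 gives 16t/alpha. *)
Lemma degree_max :
  alpha * (N - 1 - (degree u)%:R) <= t%:R + 16 * t%:R / alpha.
Proof.
have [a0 a1] := andP alpha01.
have N0 : 0 < N by rewrite ltr0n; apply: leq_trans n12.
have zge v : 0 <= z v by have /andP[] := z01 v.
have SB : \sum_(v | edge u v && (v \in B)) z v <= t%:R.
  apply: le_trans (_ : \sum_(v in B) 1 <= _); last by rewrite sumr_const ler_nat card_big.
  rewrite [leLHS]big_mkcond [leRHS]big_mkcond /=; apply: ler_sum => v _.
  by have /andP[] := z01 v; case: (v \in B); case: edge.
have SC : \sum_(v | edge u v && (v \notin B)) z v <= 16 * t%:R / alpha.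
  have aN : 0 < alpha * N / 4 by rewrite divr_gt0 ?mulr_gt0.
  rewrite -(ler_pM2l aN) mulr_sumr.
  have -> : alpha * N / 4 * (16 * t%:R / alpha) = 4 * t%:R * N.
    by field; rewrite gt_eqF.
  apply: le_trans sum_nbrs_degree_le.
  rewrite [leRHS](bigID [pred v in B]) /= -[leLHS]add0r lerD ?sumr_ge0 //.
  by apply: ler_sum => v /andP[_]; apply: small_entry.
have := perron_eq u; rewrite zu mulr1 (bigID [pred v in B]) /=.
set S1 := \sum_(i | _) _ in SB *; set S2 := \sum_(i | _) _ in SC *.
move=> E; have : rho - alpha * (degree u)%:R <= S1 + S2.
  rewrite E ler_piMl ?addr_ge0 ?sumr_ge0 // lerBlDr lerDl; exact: ltW.
move: rho (16 * t%:R / alpha) t%:R (degree u)%:R N S1 S2 SB SC rho_ge {E}.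
by move=> r k T d n S1 S2 SB SC r_ge; lra.
Qed.

(** Bounds the degree of a vertex outside the core: at most 3t common neighbours with [u], plus n -
    deg u = 1 + (n - 1 - deg u), the latter controlled by [degree_max]. *)
Let C : R := 3 * t%:R + 1 + (t%:R + 16 * t%:R / alpha) / alpha.
Let S := \sum_(w in L) z w.
Hypothesis nC : 2 * (C + 1) <= N.

Lemma C_ge0 : 0 <= C.
Proof.
have [a0 a1] := andP alpha01.
by rewrite /C !(addr_ge0, divr_ge0, mulr_ge0) // ltW.
Qed.

Lemma outside_degree v : v \notin L -> (degree v)%:R <= C.
Proof.
have [a0 a1] := andP alpha01.
rewrite !inE negb_or negb_and => /andP[->] /=; rewrite -ltnNge => cv.
have := degree_codegree G u v; move/leq_trans/(_ (leq_add (ltnW cv) (leqnn _))).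
rewrite -(ler_nat R) natrD [leRHS]natrD natrM.
have : N - 1 - (degree u)%:R <= (t%:R + 16 * t%:R / alpha) / alpha.
  by rewrite ler_pdivlMr // mulrC; exact: degree_max.
rewrite /C; move: ((t%:R + 16 * t%:R / alpha) / alpha) N t%:R (degree u)%:R (degree v)%:R => k n T d e; lra.
Qed.

Lemma outside_coef v : v \notin L ->
  alpha * (N - (C + 1)) <= rho - alpha * (degree v)%:R.
Proof.
have [a0 a1] := andP alpha01.
move=> /outside_degree dv.
have : alpha * (degree v)%:R <= alpha * C by rewrite ler_pM2l.
move: rho (degree v)%:R N C rho_ge => r d n c r_ge; lra.
Qed.

Lemma sum_nbrs_ge0 x : 0 <= \sum_(y | edge x y) z y.
Proof. by apply: sumr_ge0 => y _; have /andP[] := z01 y. Qed.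

(** First pass: all neighbouring entries are bounded by 1. The factor 2 comes from N - (C+1) >=
    N/2. *)
Lemma outside_entry_crude v : v \notin L -> z v <= 2 * C / (alpha * N).
Proof.
have [a0 a1] := andP alpha01 => vL.
have N0 : 0 < N by rewrite ltr0n; apply: leq_trans n12.
have /andP[zv0 zv1] := z01 v.
rewrite ler_pdivlMr ?mulr_gt0 //.
have h1 : alpha * (N - (C + 1)) * z v <= C.
  apply: le_trans (ler_wpM2r zv0 (outside_coef _ vL)) _; rewrite perron_eq.
  apply: le_trans (outside_degree _ vL); apply: le_trans (sum_nbrs_le v).
  by rewrite ler_piMl ?sum_nbrs_ge0 // lerBlDr lerDl ltW.
have : alpha * z v * (2 * (C + 1)) <= alpha * z v * N by rewrite ler_wpM2l // mulr_ge0 // ltW.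
move: (z v) N C h1 => y n c h1; lra.
Qed.

(** Second pass: core neighbours sum to at most [S], and the at most [C] neighbours outside now obey
    the crude bound. *)
Lemma outside_entry v : v \notin L ->
  alpha * (N - (C + 1)) * z v <= (1 - alpha) * (S + 2 * C ^+ 2 / alpha / N).
Proof.
have [a0 a1] := andP alpha01 => vL.
have N0 : 0 < N by rewrite ltr0n; apply: leq_trans n12.
have /andP[zv0 zv1] := z01 v.
apply: le_trans (ler_wpM2r zv0 (outside_coef _ vL)) _; rewrite perron_eq.
apply: ler_wpM2l; first by rewrite subr_ge0 ltW.
rewrite (bigID [pred w in L]) /=; apply: lerD.
  rewrite [leLHS]big_mkcond /S [leRHS]big_mkcond /=; apply: ler_sum => w _.
  by have /andP[] := z01 w; case: (w \in L); case: edge.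
apply: le_trans (_ : \sum_(w | edge v w) (2 * C / (alpha * N)) <= _).
  rewrite [leLHS]big_mkcond [leRHS]big_mkcond /=; apply: ler_sum => w _.
  have c0 : 0 <= 2 * C / (alpha * N).
    by rewrite divr_ge0 ?mulr_ge0 ?C_ge0 // ltW.
  case: edge => //=; case: ifP => // wL; apply: outside_entry_crude; exact: wL.
rewrite sumr_const -[leLHS]mulr_natr -[#|_|]/(degree v).
have -> : 2 * C ^+ 2 / alpha / N = 2 * C / (alpha * N) * C.
  by field; rewrite !gt_eqF.
apply: ler_wpM2l (outside_degree _ vL).
by rewrite divr_ge0 ?mulr_ge0 ?C_ge0 // ltW.
Qed.

Lemma core_sum_le : S <= #|L|%:R.
Proof.
rewrite /S -sum1_card natr_sum; apply: ler_sum => w _.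
by have /andP[] := z01 w.
Qed.

Lemma core_row x : x \in L ->
  rho * z x <= alpha * (degree x)%:R * z x - (1 - alpha) * z x
    + (1 - alpha) / alpha * S
    + 2 * (2 * C ^+ 2 / alpha + (C + 1) * t%:R) / alpha / N.
Proof.
have [a0 a1] := andP alpha01 => xL.
have N0 : 0 < N by rewrite ltr0n; apply: leq_trans n12.
have zge v : 0 <= z v by have /andP[] := z01 v.
have b0 : 0 < 1 - alpha by rewrite subr_gt0.
have S0 : 0 <= S by apply: sumr_ge0.
have St : S <= t%:R by apply: le_trans core_sum_le _; rewrite ler_nat card_core.
have := perron_eq x; rewrite (bigID [pred w in L]) /=.
set S1 := \sum_(i | _) _; set T := \sum_(i | _) _ => E.
(* As [x] is not its own neighbour, its entry is missing from the sum; this yields the term -(1 -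
   alpha) z_x. *)
have S1S : S1 <= S - z x.
  rewrite /S (bigD1 x) //= [leRHS]addrAC subrr add0r /S1.
  rewrite [leLHS]big_mkcond [leRHS]big_mkcond /=; apply: ler_sum => v _.
  case: ifP => [/andP[xv ->]|_]; last by case: ifP.
  by rewrite (contraTneq _ xv) //= => ->; rewrite edge_irr.
have c0 : 0 <= 2 * C ^+ 2 / alpha.
  apply: divr_ge0 (ltW a0); apply: mulr_ge0 => //; exact: sqr_ge0.
have TS : alpha * (N - (C + 1)) * T <= (1 - alpha) * (N * S + 2 * C ^+ 2 / alpha).
  have -> : (1 - alpha) * (N * S + 2 * C ^+ 2 / alpha) =
      (1 - alpha) * (S + 2 * C ^+ 2 / alpha / N) * N.
    by field; rewrite !gt_eqF.
  rewrite /T mulr_sumr.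
  apply: le_trans (_ : \sum_(v | edge x v && (v \notin L))
     ((1 - alpha) * (S + 2 * C ^+ 2 / alpha / N)) <= _).
    by apply: ler_sum => v /andP[_]; apply: outside_entry.
  rewrite sumr_const -[leLHS]mulr_natr; apply: ler_wpM2l; last by rewrite ler_nat max_card.
  apply: mulr_ge0; first exact: ltW.
  by apply: addr_ge0 => //; apply: divr_ge0 => //; apply: ltW.
have C0 := C_ge0.
have d0 : 0 <= C + 1 by apply: addr_ge0.
have := core_row_arith _ _ _ _ _ _ _ _ a0 a1 S0 St c0 d0 N0 nC TS.
(* The first summand pays for the core neighbours of [x], the second for those outside. *)
have -> : (1 - alpha) / alpha * S = (1 - alpha) * S + (1 - alpha) ^+ 2 / alpha * S.
  by field; rewrite gt_eqF.
have : (1 - alpha) * S1 <= (1 - alpha) * (S - z x) by rewrite ler_pM2l.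
move: (2 * (2 * C ^+ 2 / alpha + (C + 1) * t%:R) / alpha / N) => k.
move: ((1 - alpha) ^+ 2 / alpha * S) E S1S => m.
clear TS; move: rho S S1 T (z x) (degree x)%:R => r s s1 T' y d; lra.
Qed.
End PerronVector.

(** * The core has t vertices, all of them dominating *)

Lemma core_max_arith (R : realFieldType) (a q N d r S t k c : R) :
  0 < a -> d <= N - 1 ->
  a * (N - 1) - (1 - a) + q * t - k <= r ->
  r <= a * d - (1 - a) + q * S + c ->
  q * (t - S) <= k + c.
Proof.
move=> a0 dN rk rc; have : a * d <= a * (N - 1) by rewrite ler_pM2l.
lra.
Qed.

(** A core vertex of degree at most N - 2 falls short by a y >= a/2, while the error terms total at
    most (t+1)(k+c), because q t (1-y) <= t (k+c). With k and c of order 1/N this fails for large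
    N. *)
Lemma core_entry_arith (R : realFieldType) (a q N d r y S t k c : R) :
  0 < a -> 0 <= q -> 0 <= t -> 0 <= k -> y <= 1 -> 1 / 2 <= y -> 1 - y <= t - S ->
  S <= t -> d <= N - 2 ->
  a * (N - 1) - (1 - a) + q * t - k <= r ->
  r * y <= a * d * y - (1 - a) * y + q * S + c ->
  q * (t - S) <= k + c ->
  a <= 2 * (t + 1) * (k + c).
Proof.
move=> a0 q0 t0 k0 y1 y2 yS St dN rk ryc qc.
have y0 : 0 <= y by lra.
have h1 : (a * (N - 1) - (1 - a) + q * t - k) * y <= r * y by rewrite ler_wpM2r.
have h2 : a * y * d <= a * y * (N - 2) by rewrite ler_wpM2l // mulr_ge0 // ltW.
have h3 : q * (1 - y) <= q * (t - S) by rewrite ler_wpM2l.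
have h4 : t * (q * (1 - y)) <= t * (k + c) by rewrite ler_wpM2l // (le_trans h3).
have h5 : k * y <= k * 1 by rewrite ler_wpM2l.
have h6 : q * S <= q * t by rewrite ler_wpM2l.
have h7 : a * (1 / 2) <= a * y by rewrite ler_pM2l.
lra.
Qed.

Lemma degree_lt (G : sgraph) (x : G) : (degree x <= #|G|.-1)%N.
Proof.
rewrite -(cardC1 x); apply/subset_leq_card/subsetP => y; rewrite !inE.
by apply: contraTneq => ->; rewrite edge_irr.
Qed.

Lemma core_dominating (R : realType) (alpha K : R) (G : sgraph) (t : nat)
    (z : G -> R) (u : G)
    (C := 3 * t%:R + 1 + (t%:R + 16 * t%:R / alpha) / alpha)
    (M := K + 2 * (2 * C ^+ 2 / alpha + (C + 1) * t%:R) / alpha) :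
  0 < alpha < 1 -> (0 < t)%N -> minor_free (quadrangles t) G ->
  (forall x, 0 <= z x <= 1) -> z u = 1 ->
  (forall x, alpha_index alpha G * z x = alpha_op alpha z x) ->
  0 <= K ->
  alpha * (#|G|%:R - 1) - (1 - alpha) + (1 - alpha) / alpha * t%:R - K / #|G|%:R
    <= alpha_index alpha G ->
  (12 <= #|G|)%N -> (9 * t <= #|G|)%N -> 2 * (C + 1) <= #|G|%:R ->
  K * alpha <= (1 - alpha) ^+ 2 * #|G|%:R ->
  2 * alpha * M <= (1 - alpha) * #|G|%:R ->
  2 * (t%:R + 1) * M < alpha * #|G|%:R ->
  exists L : {set G}, [/\ u \in L, #|L| = t &
    forall x, x \in L -> degree x = #|G|.-1].
Proof.
have card_arith (s l T : R) : s <= l -> T - s <= 1 / 2 -> T < l + 1 by clear=> *; lra.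
have entry_arith (y s T : R) : 1 - y <= T - s -> T - s <= 1 / 2 -> 1 / 2 <= y.
  by clear=> *; lra.
move=> alpha01 t0 Gfree z01 zu zop K0 rho_ge n12 n9t nC nK n6 n7.
have [a0 a1] := andP alpha01.
have b0 : 0 < 1 - alpha by rewrite subr_gt0.
have N0 : 0 < #|G|%:R :> R by rewrite ltr0n; apply: leq_trans n12.
have q0 : 0 < (1 - alpha) / alpha by rewrite divr_gt0.
have t1 : 1 <= t%:R :> R by rewrite ler1n.
(* As t >= 1, the term (1-alpha)t/alpha is at least (1-alpha) + (1-alpha)^2/alpha, and the last
   summand outweighs K/n. *)
have rho1 : alpha * (#|G|%:R - 1) <= alpha_index alpha G.
  apply: le_trans rho_ge; rewrite -addrA -[leLHS]addr0 -addrA lerD2l.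
  have : K / #|G|%:R <= (1 - alpha) ^+ 2 / alpha.
    by rewrite ler_pdivrMr // mulrAC ler_pdivlMr.
  have : (1 - alpha) / alpha * 1 <= (1 - alpha) / alpha * t%:R by rewrite ler_pM2l.
  have -> : (1 - alpha) / alpha * 1 = (1 - alpha) + (1 - alpha) ^+ 2 / alpha.
    by field; rewrite gt_eqF.
  move: (K / #|G|%:R) ((1 - alpha) ^+ 2 / alpha) ((1 - alpha) / alpha * t%:R).
  by clear=> *; lra.
have := @core_row R alpha G t z u alpha01 Gfree z01 zu zop rho1 n12 n9t nC.
have := @card_core G t u Gfree.
set L := u |: _ => cardL row.
have {}row x (xL : x \in L) := row x xL.
set S := \sum_(w in L) z w in row.
set c := _ / alpha / _ in row.
have kc : K / #|G|%:R + c = M / #|G|%:R by rewrite /M [RHS]mulrDl.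
have uL : u \in L by rewrite setU11.
have SL : S <= #|L|%:R.
  rewrite /S -sum1_card natr_sum; apply: ler_sum => w _.
  by have /andP[] := z01 w.
have Lt : #|L|%:R <= t%:R :> R by rewrite ler_nat.
have dN (x : G) : (degree x)%:R <= #|G|%:R - 1 :> R.
  rewrite lerBrDr natr1 ler_nat.
  by rewrite -(ltn_predK n12) ltnS; exact: degree_lt.
have qS : (1 - alpha) / alpha * (t%:R - S) <= K / #|G|%:R + c.
  have := row u uL; rewrite zu !mulr1.
  exact: core_max_arith a0 (dN u) rho_ge.
(* A gap below one forces |L| = t by integrality, since S <= |L| <= t; the value 1/2 also keeps
   every core entry at least 1/2. *)
have S2 : t%:R - S <= 1 / 2.
  rewrite -(ler_pM2l q0); apply: le_trans qS _; rewrite kc ler_pdivrMr //.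
  have -> : (1 - alpha) / alpha * (1 / 2) * #|G|%:R = (1 - alpha) * #|G|%:R / (2 * alpha).
    by field; rewrite gt_eqF.
  by rewrite ler_pdivlMr ?mulr_gt0 // mulrC.
have LtE : #|L| = t.
  apply/eqP; rewrite eqn_leq cardL -ltnS -(ltr_nat R) -natr1.
  exact: card_arith SL S2.
exists L; split=> // x xL; apply/eqP; rewrite eqn_leq degree_lt /= leqNgt.
apply/negP => dx.
have /andP[zx0 zx1] := z01 x.
(* Once |L| = t, the gap t - S is the sum over [L] of the nonnegative defects 1 - z_w. *)
have yS : 1 - z x <= t%:R - S.
  rewrite -LtE /S -sum1_card natr_sum -sumrB (bigD1 x) //= lerDl.
  by apply: sumr_ge0 => w _; rewrite subr_ge0; have /andP[] := z01 w.
have dx2 : (degree x)%:R <= #|G|%:R - 2 :> R.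
  by rewrite lerBrDr -natrD ler_nat addn2 -ltn_predRL.
have y2 : 1 / 2 <= z x by exact: entry_arith yS S2.
have St : S <= t%:R by apply: le_trans Lt.
have k0 : 0 <= K / #|G|%:R by rewrite divr_ge0 // ltW.
have := core_entry_arith _ _ _ _ _ _ _ _ _ _ _ a0 (ltW q0) (le_trans ler01 t1) k0
  zx1 y2 yS St dx2 rho_ge (row x xL) qS.
by rewrite kc mulrA ler_pdivlMr // leNgt n7.
Qed.

(** * Extremality of the join and the case of equality *)

Lemma isomorphic_alpha_index_ge (R : realType) (alpha : R) (G H : sgraph) :
  0 < alpha < 1 -> (0 < #|H|)%N -> isomorphic G H ->
  alpha_index alpha H <= alpha_index alpha G.
Proof.
move=> alpha01 H0 [f [[g fK gK] fE]].
apply: (alpha_index_mono _ _ _ _ g alpha01 H0); first by exists f.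
by move=> x y; rewrite -fE !gK.
Qed.

Lemma eventually_ge (R : realType) (x : R) :
  exists n0 : nat, forall n : nat, (n0 <= n)%N -> x <= n%:R.
Proof.
exists (Num.bound `|x|) => n nx; apply: le_trans (ler_norm x) _.
apply: ltW; apply: lt_le_trans (archi_boundP (normr_ge0 x)) _.
by rewrite ler_nat.
Qed.

Theorem theorem1p2 (R : realType) (alpha : R) (t : nat)
    (halpha : 0 < alpha < 1) (ht : (1 <= t)%N) :
  exists n0 : nat, forall n : nat, (n0 <= n)%N ->
    forall G : sgraph, #|G| = n -> minor_free (quadrangles t) G ->
      alpha_index alpha G
        <= alpha_index alpha (join (complete t) (matching (n - t))) /\
      (alpha_index alpha G
         = alpha_index alpha (join (complete t) (matching (n - t)))
       <-> isomorphic G (join (complete t) (matching (n - t)))).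
Proof.
have [a0 a1] := andP halpha; have b0 : 0 < 1 - alpha by rewrite subr_gt0.
pose K : R := (1 - alpha) ^+ 2 * t%:R * ((1 - alpha) / alpha * t%:R + alpha * t%:R)
          / alpha ^+ 2.
have K0 : 0 <= K.
  rewrite /K; move: (1 - alpha) b0 => b b0.
  by rewrite !(divr_ge0, mulr_ge0, exprn_ge0, addr_ge0) // ltW.
pose C : R := 3 * t%:R + 1 + (t%:R + 16 * t%:R / alpha) / alpha.
pose M : R := K + 2 * (2 * C ^+ 2 / alpha + (C + 1) * t%:R) / alpha.
(* The four thresholds solve size hypotheses of [core_dominating] for n; the [+ 1] in the last one
   yields its strict inequality. *)
have [n1 n1P] := eventually_ge R (2 * (C + 1)).
have [n2 n2P] := eventually_ge R (K * alpha / (1 - alpha) ^+ 2).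
have [n3 n3P] := eventually_ge R (2 * alpha * M / (1 - alpha)).
have [n4 n4P] := eventually_ge R (2 * (t%:R + 1) * M / alpha + 1).
exists (12 + 9 * t + n1 + n2 + n3 + n4)%N => n n0n G Gn Gfree.
have [[l12 l9 l1] [l2 l3 l4]] :
    [/\ 12 <= n, 9 * t <= n & n1 <= n]%N /\ [/\ n2 <= n, n3 <= n & n4 <= n]%N.
  by move: n0n; clear; do 2!split; lia.
have {}n1P := n1P n l1; have {}n2P := n2P n l2.
have {}n3P := n3P n l3; have {}n4P := n4P n l4.
set H := join _ _.
have tn : (t <= n)%N by move: l9; clear; lia.
have G0 : (0 < #|G|)%N by rewrite Gn; apply: leq_trans l12.
have H0 : (0 < #|H|)%N by rewrite card_sum !card_ord subnKC // -Gn.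
(* Both claims reduce to this: a larger index of [G] would contradict the first half, and equality
   feeds the second. *)
have key : alpha_index alpha H <= alpha_index alpha G ->
    alpha_index alpha G <= alpha_index alpha H /\ isomorphic G H.
  move=> HG.
  have [|z [u [z01 zu zop]]] := alpha_index_perron _ alpha G _ G0.
    by have [/ltW-> /ltW->] := andP halpha.
  have := alpha_index_join_ge R alpha t n halpha; rewrite ht tn => /(_ isT).
  move=> /le_trans/(_ HG) rho_ge.
  have [|||||||L [uL Lt dom]] := @core_dominating R alpha K G t z u halpha ht Gfree z01 zu zop K0.
  - by rewrite Gn.
  - by rewrite Gn.
  - by rewrite Gn.
  - by rewrite Gn.
  - by rewrite Gn [leRHS]mulrC -ler_pdivrMr ?exprn_gt0.
  - by rewrite Gn [leRHS]mulrC -ler_pdivrMr.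
  - rewrite Gn [ltRHS]mulrC -ltr_pdivrMr //.
    by apply: lt_le_trans n4P; rewrite ltrDl.
  have L0 : (0 < #|L|)%N by rewrite Lt.
  have tG : (3 * t + 2 <= #|G|)%N by rewrite Gn; move: l12 l9; clear; lia.
  have L1 := dominated_matching G t L Gfree L0 Lt tG dom.
  have := join_matching_embed G L L1; rewrite Lt Gn -/H => -[f [f_bij f_hom]].
  split; first exact: (alpha_index_mono _ _ _ _ f).
  exists f; split=> // x y; apply/idP/idP; last exact: f_hom.
  apply: contraTT => xy; apply/negP => fxy.
  have z0 v : 0 <= z v by have /andP[] := z01 v.
  (* A zero entry would make every term of the row at [x] vanish, but the dominating neighbour [u]
     contributes 1 - alpha. *)
  have zx : 0 < z x.
    rewrite lt_neqAle z0 andbT; apply/negP => /eqP zx.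
    have [xu|xu] := eqVneq x u; first by move: zx => /esym/eqP; rewrite xu zu oner_eq0.
    have ux : edge x u by rewrite edge_sym dominating_edge ?dom // eq_sym.
    have /eqP := zop x; rewrite -zx mulr0 eq_sym /alpha_op psumr_eq0 => [|v _]; last first.
      by rewrite addr_ge0 ?mulr_ge0 // ltW.
    move=> /allP/(_ u); rewrite mem_index_enum ux zu -zx mulr0 add0r mulr1 => /(_ isT).
    by rewrite gt_eqF.
  have := alpha_index_strict _ _ _ _ f halpha G0 f_bij f_hom z x y z0 zop zx fxy xy.
  by rewrite ltNge HG.
split.
  rewrite leNgt; apply/negP => lt.
  by have [] := key (ltW lt); rewrite leNgt lt.
split=> [E|GH]; first by have [] := key; rewrite ?E.
have HG := isomorphic_alpha_index_ge R alpha G H halpha H0 GH.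
by apply/eqP; rewrite eq_le HG andbT; have [] := key HG.
Qed.
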